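(* Let $I=[0,1]$ or $I=[0,\infty)$ and let $X$ be a symmetric space on $I$ such that both the Cesàro operator $C$ and the Copson operator $C^*$ are bounded on $X$. Then the Copson space $C^*X$ is order continuous if and only if $X$ is order continuous.
   Context: $m$ is Lebesgue measure, $L^0(I)$ the space of (a.e. classes of) real-valued Lebesgue measurable functions on $I$. A Banach function space $X$ on $I$ is a Banach space that is a linear subspace of $L^0(I)$ with the ideal property: $|f|\le|g|$ a.e., $f\in L^0(I)$, $g\in X$ imply $f\in X$ and $\|f\|_X\le\|g\|_X$; by convention $X$ also contains a function positive a.e. on $I$. A symmetric space is a Banach function space $X$ such that if $f,g\in L^0(I)$ are equimeasurable ($m\{|f|>s\}=m\{|g|>s\}$ for all $s>0$) and $f\in X$, then $g\in X$ and $\|f\|_X=\|g\|_X$. A Banach function space $E$ is order continuous if for every $f\in E$ and every decreasing sequence of measurable sets $A_n\subset I$ with empty intersection, $\|f\chi_{A_n}\|_E\to0$. Cesàro operator: $Cf(x)=\frac1x\int_0^x f(t)\,dt$ for $0<x\in I$. Copson operator: $C^*f(x)=\int_{I\cap[x,\infty)}\frac{f(t)}{t}\,dt$ for $x\in I$. $C^*X=\{f\in L^0(I): C^*|f|\in X\}$ with norm $\|f\|_{C^*X}=\|C^*|f|\|_X$. *)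

(* Defs.v *)
From HB Require Import structures.
From mathcomp Require Import all_boot all_order all_algebra.
From mathcomp Require Import all_classical all_reals all_analysis.
Set Implicit Arguments.
Unset Strict Implicit.
Unset Printing Implicit Defensive.
Import Order.TTheory GRing.Theory Num.Theory.
Import numFieldNormedType.Exports.
Local Open Scope classical_set_scope.
Local Open Scope ring_scope.

(* The real line with the sigma-algebra of Lebesgue (not merely Borel)
   measurable sets, i.e. the domain of [completed_lebesgue_measure]. *)
Notation lebesgueType R :=
  (caratheodory_type ((wlength (R := R) idfun)^*)%mu).

Notation leb := completed_lebesgue_measure.

(* A.e. classes on [I] are handled through representatives: functions on the
   whole line of which only the values on [I] matter.  The space is the set
   [carrier] of all representatives of its elements; [fnorm] is meaningful on
   [carrier] only. *)
Record function_space (R : realType) := {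
  carrier :> (lebesgueType R -> R) -> Prop ;
  fnorm : (lebesgueType R -> R) -> R }.

(* Since [|f| <= |g|] is only required a.e. on [I], [bfs_ideal] also says that
   [carrier] and [fnorm] are invariant under a.e. equality on [I]. *)
Record banach_function_space (R : realType) (I : set (lebesgueType R))
    (X : function_space R) : Prop := {
  bfs_measurable : forall f, X f -> measurable_fun I f ;
  bfs0 : X (cst 0) ;
  bfsD : forall f g, X f -> X g -> X (f \+ g) ;
  bfsZ : forall (c : R) f, X f -> X (fun t => c * f t) ;
  bfs_norm_ge0 : forall f, X f -> 0 <= fnorm X f ;
  bfs_norm_eq0 : forall f, X f -> fnorm X f = 0 ->
    {ae leb, forall t, I t -> f t = 0} ;
  bfs_normD : forall f g, X f -> X g ->
    fnorm X (f \+ g) <= fnorm X f + fnorm X g ;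
  bfs_normZ : forall (c : R) f, X f ->
    fnorm X (fun t => c * f t) = `|c| * fnorm X f ;
  bfs_complete : forall u : nat -> lebesgueType R -> R,
    (forall n, X (u n)) ->
    (forall e : R, 0 < e -> exists N : nat, forall p q : nat,
      (N <= p)%N -> (N <= q)%N -> fnorm X (u p \- u q) < e) ->
    exists2 f, X f & fnorm X (u n \- f) @[n --> \oo] --> (0 : R) ;
  bfs_ideal : forall f g : lebesgueType R -> R, measurable_fun I f -> X g ->
    {ae leb, forall t, I t -> `|f t| <= `|g t|} ->
    X f /\ fnorm X f <= fnorm X g ;
  bfs_unit : exists2 w, X w & {ae leb, forall t, I t -> 0 < w t} }.

Definition equimeasurable (R : realType) (I : set (lebesgueType R))
    (f g : lebesgueType R -> R) : Prop :=
  forall s : R, 0 < s ->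
    leb [set t | I t /\ s < `|f t|] = leb [set t | I t /\ s < `|g t|].

Definition symmetric_space (R : realType) (I : set (lebesgueType R))
    (X : function_space R) : Prop :=
  banach_function_space I X /\
  forall f g : lebesgueType R -> R, measurable_fun I f -> measurable_fun I g ->
    equimeasurable I f g -> X f -> X g /\ fnorm X f = fnorm X g.

Definition order_continuous (R : realType) (I : set (lebesgueType R))
    (E : function_space R) : Prop :=
  forall f, E f -> forall A : nat -> set (lebesgueType R),
    (forall n, measurable (A n)) -> (forall n, A n `<=` I) ->
    (forall n, A n.+1 `<=` A n) -> \bigcap_n A n = set0 ->
    fnorm E (f \* \1_(A n)) @[n --> \oo] --> (0 : R).

(* The two operators take extended real values.  For a measurable integrand of
   arbitrary sign, the integral is finite if and only if the integrand is
   Lebesgue integrable, since [+oo - +oo = -oo] in [\bar R].  The value at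
   [x = 0], where [0^-1 = 0], is irrelevant. *)
Definition cesaro_op (R : realType) (f : lebesgueType R -> R) (x : R) : \bar R :=
  (x^-1%:E * \int[leb]_(t in `[0%R, x]) (f t)%:E)%E.

Definition copson_op (R : realType) (I : set (lebesgueType R))
    (f : lebesgueType R -> R) (x : R) : \bar R :=
  (\int[leb]_(t in I `&` `[x, +oo[) (f t / (t : R))%:E)%E.

(* Finiteness is required explicitly since [fine] sends infinite values to 0. *)
Definition emem (R : realType) (I : set (lebesgueType R)) (X : function_space R)
    (F : lebesgueType R -> \bar R) : Prop :=
  {ae leb, forall x, I x -> F x \is a fin_num} /\ X (fine \o F).

Definition bounded_operator (R : realType) (I : set (lebesgueType R))
    (X : function_space R)
    (T : (lebesgueType R -> R) -> lebesgueType R -> \bar R) : Prop :=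
  exists K : R, forall f, X f ->
    emem I X (T f) /\ fnorm X (fine \o T f) <= K * fnorm X f.

Definition copson_space (R : realType) (I : set (lebesgueType R))
    (X : function_space R) : function_space R :=
  {| carrier := fun f => measurable_fun I f /\
                         emem I X (copson_op I (fun t => `|f t|)) ;
     fnorm := fun f => fnorm X (fine \o copson_op I (fun t => `|f t|)) |}.

(* Main.v *)
Require Import Defs.
From mathcomp Require Import all_boot all_order all_algebra.
From mathcomp Require Import all_classical all_reals all_analysis measurable_realfun.
From mathcomp Require Import ring.
Import Order.TTheory GRing.Theory Num.Theory.
Import numFieldNormedType.Exports.
Set Implicit Arguments.
Unset Strict Implicit.
Unset Printing Implicit Defensive.
Local Open Scope classical_set_scope.
Local Open Scope ring_scope.

(** Write [C] for the Cesaro operator and [D] for the Copson operator, so that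
the norm of [f] in the Copson space is the norm of [D |f|] in [X].

The engine in both directions is that order continuity, stated for the
restrictions of one function to sets decreasing to the empty set, implies a
dominated convergence theorem: if [|u_n| <= g] with [g] in the space and
[u_n -> 0] a.e., then [u_n -> 0] in norm ([order_continuous_dominated]).  It
rests on the ideal property and the seminorm ([normed_ideal]), common to [X] and
to its Copson space.

If [X] is order continuous and [A_n] decreases to the empty set, then
[D (|f| 1_(A_n))] is dominated by [D |f|], an element of [X], and tends to [0]
wherever [D |f|] is finite, by dominated convergence of integrals.  Hence the
Copson space is order continuous ([order_continuous_copson_space]).

For the converse the sets [A_n] cannot be handled directly, because the Copson
norm of a function may be much smaller than its norm in [X].  The two norms are
equivalent on nonincreasing functions [h], though: averaging [D h] over
[0, x] gives at least [h x / 4], so [h <= 4 C (D h)] and boundedness of [C]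
yields [norm_le_copson].  By symmetry, [f 1_(A_n)] has the same norm as
its nonincreasing rearrangement [h_n].  These functions are dominated by the
rearrangement of [f], which is in [X], hence in the Copson space because [D] is
bounded on [X].  They tend to [0] pointwise because the superlevel sets of [f] at
positive levels have finite measure: otherwise symmetry would put the constant
[1] in [X], whereas [D 1] is infinite on the half-line ([superlevel_finite]).
So [h_n -> 0] in the Copson space, and then in [X]. *)

(** * The Lebesgue sigma-algebra *)

Section lebesgue.
Context {R : realType}.
Notation L := (lebesgueType R).

Lemma borel_lebesgue (A : set R) :
  measurable A -> measurable (A : set L).
Proof. exact: sub_caratheodory. Qed.

Lemma interval_lebesgue (A : set R) : is_interval A -> measurable (A : set L).
Proof. by move=> iA; apply: borel_lebesgue; exact: is_interval_measurable. Qed.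

Lemma leb_itv (i : interval R) :
  leb [set` i] = (if (i.1 < i.2)%E then (i.2 - i.1)%E else 0).
Proof. exact: lebesgue_measure_itv. Qed.

Lemma measurable_fun_div_id (D : set L) (f : L -> R) :
  measurable_fun D f -> measurable_fun D (fun t : L => f t / (t : R)).
Proof.
move=> mf mD; apply: measurable_funM => //.
have mV : measurable_fun [set: R] (@GRing.inv R).
  rewrite -(setUv [set (0 : R)]); apply/measurable_funU => //.
    exact: measurableC.
  split; first exact: measurable_fun_set1.
  apply: open_continuous_measurable_fun.
    exact/closed_openC/closed_eq.
  by move=> x /set_mem/eqP x0; exact: inv_continuous.
move=> _ Y mY; apply: measurableI => //.
by apply: borel_lebesgue; rewrite -[X in measurable X]setTI; exact: mV.
Qed.

(** Null sets of a complete measure are measurable, so an a.e. statement holds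
off a measurable null set. *)
Lemma ae_negligible_measurable (P : L -> Prop) :
  {ae leb, forall t, P t} -> measurable (~` [set t | P t]).
Proof. exact: completed_lebesgue_measure_is_complete. Qed.

Lemma ae_neq0 : {ae (@completed_lebesgue_measure R), forall t, (t : R) <> 0}.
Proof.
exists [set (0 : R)]; split.
- exact: borel_lebesgue.
- exact: lebesgue_measure_set1.
- by move=> t /= /contrapT.
Qed.

End lebesgue.

(** * The Copson operator on absolute values *)

Section copson.
Context {R : realType} (I : set (lebesgueType R)).
Notation L := (lebesgueType R).
Local Notation copson f := (copson_op I (fun t => `|f t|%R)).
Hypotheses (mI : measurable I) (I_ge0 : forall t, I t -> 0 <= (t : R)).

Let mItail (x : R) : measurable (I `&` (`[x, +oo[%classic : set L)).
Proof. by apply: measurableI => //; exact: borel_lebesgue. Qed.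

Let integrand_ge0 (f : L -> R) (x : R) (t : L) :
  (I `&` (`[x, +oo[%classic : set L)) t -> (0 <= (`|f t| / (t : R))%:E)%E.
Proof. by case=> It _; rewrite lee_fin divr_ge0// I_ge0. Qed.

Let measurable_integrand (f : L -> R) (x : R) : measurable_fun I f ->
  measurable_fun (I `&` (`[x, +oo[%classic : set L))
    (fun t : L => (`|f t| / (t : R))%:E).
Proof.
move=> mf; apply/measurable_EFinP; apply: measurable_fun_div_id.
apply: measurableT_comp => //.
by apply: measurable_funS mf => //; exact: subIsetl.
Qed.

Lemma copson_ge0 (f : L -> R) (x : R) :
  (0 <= copson f x)%E.
Proof. by apply: integral_ge0 => t; exact: (@integrand_ge0 _ x t). Qed.

Lemma copson_antitone (f : L -> R) (x y : R) : measurable_fun I f -> x <= y ->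
  (copson f y <= copson f x)%E.
Proof.
move=> mf xy; apply: ge0_subset_integral.
- exact: mItail.
- exact: mItail.
- exact: measurable_integrand.
- by move=> t; exact: (@integrand_ge0 _ x t).
- by apply: setIS => t /=; rewrite !in_itv/= !andbT; exact: le_trans.
Qed.

(** The Copson function is nonincreasing, so its superlevel sets are intervals. *)
Lemma measurable_copson (f : L -> R) : measurable_fun I f ->
  measurable_fun I (copson f : L -> \bar R).
Proof.
move=> mf _; apply: (measurability _ (ErealGenOInfty.measurableE R)) => //.
move=> _ [_ [x ->] <-]; apply: measurableI => //.
apply: interval_lebesgue => s t /= fs ft u /andP[su ut].
move: ft; rewrite !in_itv/= !andbT => ft; apply: lt_le_trans ft _.
exact: copson_antitone.
Qed.

Lemma measurable_fine_copson (f : L -> R) : measurable_fun I f ->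
  measurable_fun I (fine \o copson f : L -> R).
Proof.
by move=> mf; apply: measurableT_comp; [exact: fine_measurable|exact: measurable_copson].
Qed.

Lemma copson_le (f g : L -> R) (x : R) :
  measurable_fun I f -> measurable_fun I g ->
  {ae leb, forall t, I t -> `|f t| <= `|g t|} ->
  (copson f x <= copson g x)%E.
Proof.
move=> mf mg fg; apply: ae_ge0_le_integral.
- exact: mItail.
- by move=> t; exact: (@integrand_ge0 _ x t).
- exact: measurable_integrand.
- by move=> t; exact: (@integrand_ge0 _ x t).
- exact: measurable_integrand.
apply: filterS fg => t fg [It _].
by rewrite lee_fin ler_wpM2r ?invr_ge0 ?I_ge0// fg.
Qed.

Lemma copson_leD (f g : L -> R) (x : R) :
  measurable_fun I f -> measurable_fun I g ->
  (copson (f \+ g)%R x <=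
   copson f x + copson g x)%E.
Proof.
move=> mf mg; rewrite /copson_op -ge0_integralD; first last.
- exact: measurable_integrand.
- by move=> t; exact: (@integrand_ge0 _ x t).
- exact: measurable_integrand.
- by move=> t; exact: (@integrand_ge0 _ x t).
- exact: mItail.
apply: ge0_le_integral.
- exact: mItail.
- by move=> t; exact: (@integrand_ge0 _ x t).
- by apply: measurable_integrand; exact: measurable_funD.
- by apply: emeasurable_funD; exact: measurable_integrand.
move=> t [It _].
by rewrite -EFinD lee_fin -mulrDl ler_wpM2r ?invr_ge0 ?I_ge0// ler_normD.
Qed.

Lemma copsonZ (c : R) (f : L -> R) (x : R) : measurable_fun I f ->
  copson (fun t => c * f t)%R x =
  (`|c|%:E * copson f x)%E.
Proof.
move=> mf; rewrite /copson_op -ge0_integralZl_EFin; last first.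
- exact: normr_ge0.
- exact: measurable_integrand.
- by move=> t; exact: (@integrand_ge0 _ x t).
- exact: mItail.
by apply: eq_integral => t _; rewrite normrM -mulrA EFinM.
Qed.

(** Finiteness of the Copson integral of [|f|] at [x] says that its integrand is
integrable, and it dominates the integrands of all the restrictions of [f]. *)
Lemma copson_cvg0 (f : L -> R) (A : nat -> set L) (x : R) :
  measurable_fun I f -> (forall n, measurable (A n)) ->
  (forall n, A n.+1 `<=` A n) -> \bigcap_n A n = set0 ->
  copson f x \is a fin_num ->
  copson (f \* \1_(A n))%R x @[n --> \oo] --> (0 : \bar R).
Proof.
move=> mf mA dA A0 finf.
have mfA n : measurable_fun I (f \* \1_(A n)).
  by apply: measurable_funM => //; exact: measurable_indic.
have eventually_notin : forall t : L, I t -> \forall n \near \oo, t \notin A n.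
  move=> t _.
  have [m Am] : exists m, ~ A m t.
    apply/existsNP => At; have : (\bigcap_n A n) t by move=> n _.
    by rewrite A0.
  exists m => // n /= mn; apply/negP => /set_mem Ant; apply: Am.
  elim: n mn Ant => [|n ih]; first by rewrite leqn0 => /eqP ->.
  by rewrite leq_eqVlt => /orP[/eqP -> //|mn] /dA; exact: ih.
have cvg_integrand : {ae (@completed_lebesgue_measure R), forall t,
    (I `&` (`[x, +oo[%classic : set L)) t ->
    (`|(f \* \1_(A n)) t| / (t : R))%:E @[n --> \oo] --> cst 0%E t}.
  apply: aeW => t [It _]; apply: cvg_near_cst.
  apply: filterS (eventually_notin t It) => n /negbTE tA.
  by rewrite /= indicE tA mulr0 normr0 mul0r.
have integrable_f : (@completed_lebesgue_measure R).-integrable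
    (I `&` (`[x, +oo[%classic : set L)) (fun t : L => (`|f t| / (t : R))%:E).
  apply/integrableP; split; first exact: measurable_integrand.
  move: finf; rewrite ge0_fin_numE ?copson_ge0//.
  rewrite /copson_op; congr (_ < _)%E; apply: eq_integral => t /set_mem tI.
  by rewrite gee0_abs// (@integrand_ge0 f x).
have dominated : {ae (@completed_lebesgue_measure R), forall (t : L) (n : nat),
    (I `&` (`[x, +oo[%classic : set L)) t ->
    (`|(`|(f \* \1_(A n)) t| / (t : R))%:E| <= (`|f t| / (t : R))%:E)%E}.
  apply: aeW => t n It; rewrite gee0_abs; last by rewrite (@integrand_ge0 _ x).
  case: It => It _.
  rewrite lee_fin ler_wpM2r ?invr_ge0 ?I_ge0//= normrM ler_piMr//.
  by rewrite indicE normr_nat lern1 leq_b1.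
have [_ _] := dominated_convergence (mItail x)
  (fun n => @measurable_integrand _ x (mfA n)) (measurable_cst _)
  cvg_integrand integrable_f dominated.
by rewrite integral0.
Qed.

End copson.

(** * Dominated convergence in order continuous spaces *)

(** The part of the structure of a Banach function space that its Copson space
inherits from it, and on which the dominated convergence theorem rests. *)
Record normed_ideal (R : realType) (I : set (lebesgueType R))
    (E : function_space R) : Prop := {
  ideal_measurable : forall f, E f -> measurable_fun I f ;
  idealD : forall f g, E f -> E g ->
    E (f \+ g) /\ fnorm E (f \+ g) <= fnorm E f + fnorm E g ;
  idealZ : forall (c : R) f, E f ->
    E (fun t => c * f t) /\ fnorm E (fun t => c * f t) = `|c| * fnorm E f ;
  ideal_le : forall f g : lebesgueType R -> R, measurable_fun I f -> E g ->
    {ae leb, forall t, I t -> `|f t| <= `|g t|} ->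
    E f /\ fnorm E f <= fnorm E g }.

Section normed_ideal_theory.
Context {R : realType} (I : set (lebesgueType R)) (E : function_space R).
Notation L := (lebesgueType R).
Hypotheses (mI : measurable I) (iE : normed_ideal I E).

Lemma ideal_norm_ge0 (f : L -> R) : E f -> 0 <= fnorm E f.
Proof.
move=> Ef; have [E0 n0] := idealZ iE 0 Ef.
have <- : fnorm E (fun t => 0 * f t) = 0 by rewrite n0 normr0 mul0r.
apply: (ideal_le iE (ideal_measurable iE E0) Ef _).2.
by apply: aeW => t _; rewrite mul0r normr0.
Qed.

Lemma ideal_restrict (f : L -> R) (A : set L) : measurable A -> E f ->
  E (f \* \1_A).
Proof.
move=> mA Ef; apply: (ideal_le iE _ Ef _).1.
  by apply: measurable_funM; [exact: ideal_measurable Ef|exact: measurable_indic].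
apply: aeW => t _; rewrite normrM ler_piMr//.
by rewrite indicE normr_nat lern1 leq_b1.
Qed.

(** For [d > 0] let [B n] be the set where [|u k| > d g] for some [k >= n].  The
sets [B n] decrease to the empty set, since [u k t] tends to [0], and
[|u n| <= g 1_(B n) + d g], so the norm of [u n] is eventually at most
[d] times the norm of [g], up to an arbitrarily small error. *)
Lemma order_continuous_dominated (g : L -> R) (u : nat -> L -> R) :
  order_continuous I E -> E g -> (forall n, measurable_fun I (u n)) ->
  {ae leb, forall t, I t -> (forall n, `|u n t| <= g t) /\
                            u n t @[n --> \oo] --> (0 : R)} ->
  fnorm E (u n) @[n --> \oo] --> (0 : R).
Proof.
move=> ocE Eg mu uP; have mg := ideal_measurable iE Eg.
have mN := ae_negligible_measurable uP.
set N := ~` _ in mN.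
have NP t : I t -> ~ N t -> (forall n, `|u n t| <= g t) /\
    u n t @[n --> \oo] --> (0 : R).
  by move=> It /contrapT; exact.
apply/cvgr0Pnorm_lt => e e0.
(* The [+ 1] keeps [d] meaningful when [g] has norm zero. *)
pose d := e / 2 / (fnorm E g + 1).
have g0 := ideal_norm_ge0 Eg.
have d0 : 0 < d by rewrite !divr_gt0// ltr_wpDl.
have dg : d * fnorm E g <= e / 2.
  rewrite /d mulrAC -mulrA ler_piMr ?divr_ge0// ?(ltW e0)//.
  by rewrite ler_pdivrMr ?mul1r ?lerDl// ltr_wpDl.
(* The exceptional set [N] is removed so that the intersection of the [B n] is
   exactly empty, not just negligible. *)
pose C k := (I `\` N) `&` [set t | d * g t < `|u k t|].
pose B n := \bigcup_(k in [set k | (n <= k)%N]) C k.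
have mC k : measurable (C k).
  have mD : measurable (I `\` N) by exact: measurableD.
  have mlt : measurable_fun (I `\` N) (fun t => d * g t < `|u k t|).
    apply: measurable_fun_ltr.
      apply: measurable_funM => //.
      by apply: measurable_funS mg => //; exact: subDsetl.
    apply: measurableT_comp => //.
    by apply: measurable_funS (mu k) => //; exact: subDsetl.
  by have := mlt mD [set true]; apply.
have mB n : measurable (B n) by apply: bigcup_measurable.
have BI n : B n `<=` I by move=> t [k _ [[]]].
have dB n : B n.+1 `<=` B n.
  by move=> t [k /= nk Ckt]; exists k => //=; exact: ltnW.
have B0 : \bigcap_n B n = set0.
  rewrite -subset0 => t Bt.
  have [k0 _ [[It Nt] _]] := Bt 0%N Logic.I.
  have [ug u0] := NP t It Nt.
  have [gt0|gt0] := ltP 0 (g t).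
    have /cvgr0Pnorm_lt/(_ _ (mulr_gt0 d0 gt0)) [m _ mP] := u0.
    have [k /= mk [_ /=]] := Bt m Logic.I.
    by rewrite ltNge (ltW (mP k mk)).
  have [k _ [_ /=]] := Bt 0%N Logic.I.
  have := ug k; have := normr_ge0 (u k t) => u_ge0 ugk.
  have g_ge0 : 0 <= g t by exact: le_trans ugk.
  have -> : g t = 0 by apply: le_anti; rewrite gt0.
  rewrite mulr0 => /lt_le_trans /(_ ugk); rewrite ltNge gt0//.
have := ocE g Eg B mB BI dB B0.
move=> /cvgr0Pnorm_lt /(_ (e / 2)); rewrite divr_gt0// => /(_ isT).
apply: filterS => n.
have EgB := ideal_restrict (mB n) Eg.
have [Edg ndg] := idealZ iE d Eg.
have [Esum nsum] := idealD iE EgB Edg.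
have [Eu nu] : E (u n) /\
    fnorm E (u n) <= fnorm E ((g \* \1_(B n)) \+ (fun t => d * g t)).
  apply: (ideal_le iE) => //; apply: filterS uP => t + It => /(_ It) tP.
  have [ug _] := tP.
  have gt_ge0 : 0 <= g t by apply: le_trans (ug n); exact: normr_ge0.
  apply: le_trans (ler_norm _) => /=; rewrite indicE.
  have [tB|tB] := boolP (t \in B n).
    by rewrite mulr1 (le_trans (ug n))// lerDl mulr_ge0// ltW.
  rewrite mulr0 add0r leNgt; apply: contra tB => tu.
  apply/mem_set; exists n => //=; split => //; split => //.
  by rewrite /N /=; apply => _.
rewrite !ger0_norm ?ideal_norm_ge0// => nB.
apply: (le_lt_trans nu); apply: (le_lt_trans nsum).
rewrite ndg gtr0_norm// [ltRHS](splitr e).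
by rewrite ltr_leD.
Qed.

End normed_ideal_theory.

Lemma bfs_normed_ideal (R : realType) (I : set (lebesgueType R))
  (X : function_space R) : banach_function_space I X -> normed_ideal I X.
Proof.
move=> bX; split.
- exact: bfs_measurable bX.
- by move=> f g Xf Xg; split; [exact: bfsD bX _ _ Xf Xg|exact: bfs_normD bX _ _ Xf Xg].
- by move=> c f Xf; split; [exact: bfsZ bX c _ Xf|exact: bfs_normZ bX c _ Xf].
- exact: bfs_ideal bX.
Qed.

Section copson_space_ideal.
Context {R : realType} (I : set (lebesgueType R)) (X : function_space R).
Notation L := (lebesgueType R).
Local Notation copson f := (copson_op I (fun t => `|f t|%R)).
Hypotheses (mI : measurable I) (I_ge0 : forall t, I t -> 0 <= (t : R)).
Hypothesis iX : normed_ideal I X.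

(** The reduction of membership and norm bounds in the Copson space to pointwise
bounds: an upper bound of the Copson function in [X] also forces it to be
finite a.e. *)
Lemma copson_space_le (f : L -> R) (h : L -> R) : measurable_fun I f ->
  X h -> {ae leb, forall x, I x -> (copson f x <= (h x)%:E)%E} ->
  copson_space I X f /\ fnorm (copson_space I X) f <= fnorm X h.
Proof.
move=> mf Xh fh.
have fin : {ae leb, forall x, I x -> copson f x \is a fin_num}.
  apply: filterS fh => x fh Ix.
  by rewrite ge0_fin_numE ?copson_ge0// (le_lt_trans (fh Ix))// ltry.
have [Xf nf] : X (fine \o copson f) /\ fnorm X (fine \o copson f) <= fnorm X h.
  apply: (ideal_le iX) => //; first exact: measurable_fine_copson.
  apply: filterS2 fh fin => x fh fin Ix.
  rewrite ger0_norm /= ?fine_ge0 ?copson_ge0//.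
  apply: le_trans (ler_norm _).
  by rewrite -lee_fin fineK ?fin// fh.
by split.
Qed.

Lemma copson_normed_ideal : normed_ideal I (copson_space I X).
Proof.
split.
- by move=> f [].
- move=> f g [mf [finf Xf]] [mg [fing Xg]].
  have [Xfg nfg] := idealD iX Xf Xg.
  have [Cfg nC] : copson_space I X (f \+ g) /\
      fnorm (copson_space I X) (f \+ g) <=
      fnorm X ((fine \o copson f) \+ (fine \o copson g)).
    apply: copson_space_le => //; first exact: measurable_funD.
    apply: filterS2 finf fing => x finf fing Ix.
    rewrite (le_trans (copson_leD _ _ _ _ _))//= EFinD !fineK ?finf ?fing//.
  by split => //; exact: le_trans nfg.
- move=> c f [mf [finf Xf]]; have [Xcf ncf] := idealZ iX `|c| Xf.
  have -> : fnorm (copson_space I X) (fun t => c * f t) =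
      fnorm X (fun x => `|c| * (fine \o copson f) x).
    congr (fnorm X _); apply/funext => x /=.
    rewrite (copsonZ mI I_ge0)//; have := copson_ge0 I_ge0 f x.
    (* An infinite value becomes 0 under [fine], before or after scaling. *)
    case: (copson f x) => //= _; rewrite mulr0.
    by have [->|c0] := eqVneq `|c| 0; rewrite ?mul0e// gt0_muley// lte_fin lt0r c0/=.
  rewrite ncf normr_id; split; last by [].
  suff [] : copson_space I X (fun t => c * f t) /\
    fnorm (copson_space I X) (fun t => c * f t) <=
    fnorm X (fun x => `|c| * (fine \o copson f) x) by [].
  apply: copson_space_le Xcf _.
    by apply: measurable_funM mf; exact: measurable_cst.
  apply: filterS finf => x finf Ix.
  by rewrite (copsonZ mI I_ge0)//= EFinM fineK ?finf.
- move=> f g mf [mg [fing Xg]] fg.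
  apply: (copson_space_le mf Xg); apply: filterS fing => x fing Ix.
  by rewrite /= fineK ?fing// copson_le.
Qed.

End copson_space_ideal.

(** * Order continuity passes to the Copson space *)

Section order_continuity_of_copson_space.
Context {R : realType} (I : set (lebesgueType R)) (X : function_space R).
Notation L := (lebesgueType R).
Local Notation copson f := (copson_op I (fun t => `|f t|%R)).
Hypotheses (mI : measurable I) (I_ge0 : forall t, I t -> 0 <= (t : R)).

(** The Copson functions of the restrictions of [f] are dominated by that of [f],
which is in [X], and tend to [0] wherever the latter is finite. *)
Lemma order_continuous_copson_space : normed_ideal I X ->
  order_continuous I X -> order_continuous I (copson_space I X).
Proof.
move=> iX ocX f [mf [finf Xf]] A mA _ dA A0.
have mfA n : measurable_fun I (f \* \1_(A n)).
  by apply: measurable_funM => //; exact: measurable_indic.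
apply: (order_continuous_dominated mI iX ocX Xf) => [n|].
  exact: measurable_fine_copson.
apply: filterS finf => x + Ix => /(_ Ix) fin; split.
  move=> n; rewrite /= ger0_norm ?fine_ge0 ?copson_ge0//.
  have le_fA : (copson (f \* \1_(A n)) x <= copson f x)%E.
    apply: copson_le => //; apply: aeW => t _; rewrite normrM ler_piMr//.
    by rewrite indicE normr_nat lern1 leq_b1.
  rewrite fine_le// ge0_fin_numE ?copson_ge0//.
  by rewrite (le_lt_trans le_fA)// -ge0_fin_numE ?copson_ge0.
exact: fine_cvg (copson_cvg0 mI I_ge0 mf mA dA A0 fin).
Qed.

(** Keeping only the block [[a, b]] of the domain of integration, on which the
integrand is at least [c / b].  Used with [b = 2 a], where the bound is
independent of the scale: this is what makes the Copson function of a constant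
infinite and that of a nonincreasing function comparable to the function. *)
Lemma copson_ge_block (f : L -> R) (a b c x : R) : measurable_fun I f ->
  `[a, b] `<=` I -> 0 < a <= b -> x <= a -> 0 <= c ->
  (forall t : R, a <= t <= b -> c <= `|f t|) ->
  ((c / b * (b - a))%:E <= copson f x)%E.
Proof.
move=> mf abI /andP[a0 ab] xa c0 cf.
have mab : measurable (`[a, b]%classic : set L) by exact: borel_lebesgue.
have mf_tail (D : set L) : measurable D -> D `<=` I ->
    measurable_fun D (fun t : L => (`|f t| / (t : R))%:E).
  move=> mD DI; apply/measurable_EFinP; apply: measurable_fun_div_id.
  by apply: measurableT_comp => //; apply: measurable_funS mf.
have mtail : measurable (I `&` (`[x, +oo[%classic : set L)).
  by apply: measurableI => //; exact: borel_lebesgue.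
apply: (@le_trans _ _ (\int[leb]_(t in (`[a, b]%classic : set L))
    (`|f t|%R / (t : R))%:E)%E); last first.
  apply: ge0_subset_integral.
  - exact: mab.
  - exact: mtail.
  - by apply: mf_tail; [exact: mtail|exact: subIsetl].
  - by move=> t [It _]; rewrite lee_fin divr_ge0// I_ge0.
  - move=> t tab; split; first exact: abI.
    by move: tab; rewrite /= !in_itv/= andbT => /andP[/(le_trans xa)].
apply: (@le_trans _ _ (\int[leb]_(t in (`[a, b]%classic : set L))
    cst (c / b)%:E t)%E).
  rewrite integral_cst; last exact: mab.
  rewrite [X in (_ * X)%E]leb_itv/= lte_fin EFinM lee_wpmul2l//.
    by rewrite lee_fin divr_ge0// (le_trans (ltW a0)).
  rewrite EFinB; case: ltP => [_|ba]; first exact: lexx.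
  by rewrite -EFinB lee_fin subr_le0.
apply: ge0_le_integral.
- exact: mab.
- by move=> t _; rewrite lee_fin divr_ge0// (le_trans (ltW a0)).
- exact: measurable_cst.
- by apply: mf_tail; [exact: mab|exact: abI].
move=> t; rewrite /= in_itv/= => /andP[at_ tb].
have t0 : 0 < (t : R) by exact: lt_le_trans at_.
rewrite lee_fin ler_pM// ?invr_ge0 ?(le_trans (ltW a0))//.
  by apply: cf; rewrite at_.
by rewrite lef_pV2 ?posrE// (lt_le_trans t0).
Qed.

End order_continuity_of_copson_space.

(** * Nonincreasing rearrangement *)

Section rearrangement.
Context {R : realType} (I : set (lebesgueType R)).
Notation L := (lebesgueType R).
Hypotheses (mI : measurable I).
Hypothesis I_initial : forall t : R, 0 < t -> (t%:E < leb I)%E -> I t.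

Definition superlevel (f : L -> R) (s : R) : set L :=
  [set t | I t /\ s < `|f t|].

(** Its value at [t > 0] is a true supremum as soon as the superlevel sets of [f]
have finite measure.  The value [0] at [t <= 0] makes the superlevel set at
[s >= 0] equal to the open interval from [0] to the measure of
[superlevel f s], with no endpoint to discard. *)
Definition rearrangement (f : L -> R) (t : L) : R :=
  if 0 < (t : R) then sup [set s | 0 <= s /\ ((t : R)%:E < leb (superlevel f s))%E]
  else 0.

Lemma measurable_superlevel (f : L -> R) (s : R) : measurable_fun I f ->
  measurable (superlevel f s).
Proof.
move=> mf; have mlt : measurable_fun I (fun t => s < `|f t|).
  by apply: measurable_fun_ltr; [exact: measurable_cst|exact: measurableT_comp].
have mtrue : measurable [set true] by [].
exact: mlt mI _ mtrue.
Qed.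

Lemma leb_superlevel_antitone (f : L -> R) (s s' : R) : measurable_fun I f ->
  s <= s' -> (leb (superlevel f s') <= leb (superlevel f s))%E.
Proof.
move=> mf ss'; apply: le_measure; rewrite ?inE; try exact: measurable_superlevel.
by move=> t [It s't]; split => //; exact: le_lt_trans s't.
Qed.

(** Right continuity of the distribution function: the superlevel set at [s] is
the increasing union of those at [s + 1 / n.+1]. *)
Lemma leb_superlevel_gt (f : L -> R) (s : R) (x : \bar R) :
  measurable_fun I f -> (x < leb (superlevel f s))%E ->
  exists2 s', s < s' & (x < leb (superlevel f s'))%E.
Proof.
move=> mf xs.
pose F n := superlevel f (s + n.+1%:R^-1).
have FE : \bigcup_n F n = superlevel f s.
  apply/seteqP; split=> t.
    move=> [n _ [It snt]]; split=> //; apply: lt_trans snt.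
    by rewrite ltrDl invr_gt0.
  move=> [It st].
  have [n _ nP] := near_infty_natSinv_lt (PosNum (etrans (subr_gt0 s `|f t|) st)).
  exists n => //; split=> //.
  by have := nP n (leqnn n); rewrite /= ltrBrDl.
have mF n : measurable (F n) by exact: measurable_superlevel.
have mFE : measurable (\bigcup_n F n) by rewrite FE; exact: measurable_superlevel.
have ndF : nondecreasing_seq F.
  move=> m n mn; apply/subsetPset => t [It st]; split=> //; apply: le_lt_trans st.
  by rewrite lerD2l lef_pV2 ?posrE// ler_nat ltnS.
have := @nondecreasing_cvg_mu _ _ _ (@completed_lebesgue_measure R) F mF mFE ndF.
rewrite FE => Fs.
have [n _ nP] := Fs _ (open_ereal_gt' xs).
exists (s + n.+1%:R^-1); first by rewrite ltrDl invr_gt0.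
exact: nP n (leqnn n).
Qed.

Lemma leb_initial (r : \bar R) : (0 <= r)%E ->
  leb [set t : L | 0 < (t : R) /\ ((t : R)%:E < r)%E] = r.
Proof.
case: r => [r|_|//].
  rewrite lee_fin => r0.
  rewrite [X in leb X](_ : _ = `]0, r[%classic); last first.
    by apply/seteqP; split=> t /=; rewrite in_itv/= lte_fin => /andP.
  rewrite [LHS]leb_itv/= lte_fin.
  have [_|r_le0] := ltP 0 r; first by rewrite oppr0 adde0.
  by congr (_%:E); apply: le_anti; rewrite r0.
rewrite [X in leb X](_ : _ = `]0, +oo[%classic); last first.
  by apply/seteqP; split=> t /=; rewrite in_itv/= andbT ltry => // -[].
by rewrite [LHS]leb_itv/= ltry.
Qed.

Lemma measurable_initial (r : \bar R) :
  measurable [set t : L | 0 < (t : R) /\ ((t : R)%:E < r)%E].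
Proof.
apply: interval_lebesgue => s t /= [s0 sr] [t0 tr] u /andP[su ut].
by split; [exact: lt_le_trans su|apply: le_lt_trans tr; rewrite lee_fin].
Qed.

Section one_function.
Variable f : L -> R.
Hypothesis mf : measurable_fun I f.
Hypothesis fin : forall s, 0 < s -> (leb (superlevel f s) < +oo)%E.

(** The superlevel sets at [1, 2, ...] decrease to the empty set and have finite
measure. *)
Lemma leb_superlevel_lt (x : R) : 0 < x ->
  exists2 s, 0 < s & (leb (superlevel f s) < x%:E)%E.
Proof.
move=> x0; pose F n := superlevel f n.+1%:R.
have FE : \bigcap_n F n = set0.
  rewrite -subset0 => t Ft.
  have [_] := Ft (Num.bound `|f t|) Logic.I; apply/negP; rewrite -leNgt.
  by rewrite (le_trans (ltW (archi_boundP (normr_ge0 (f t)))))// ler_nat.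
have mF n : measurable (F n) by exact: measurable_superlevel.
have niF : nonincreasing_seq F.
  move=> m n mn; apply/subsetPset => t [It st]; split=> //; apply: le_lt_trans st.
  by rewrite ler_nat ltnS.
have mFE : measurable (\bigcap_n F n) by rewrite FE.
have := @nonincreasing_cvg_mu _ _ _ (@completed_lebesgue_measure R) F (fin ltr01) mF mFE niF.
rewrite FE measure0 => F0.
have x0E : (0 < x%:E)%E by rewrite lte_fin.
have [n _ nP] := F0 _ (open_ereal_lt' x0E).
exists n.+1%:R; first by [].
exact: nP n (leqnn n).
Qed.

(** The rearrangement is the inverse of the distribution function; right
continuity of the latter is what makes this hold with strict inequalities.
Everything about rearrangements below follows from this equivalence. *)
Lemma rearrangement_gt (s : R) (t : L) : 0 < (t : R) -> 0 <= s ->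
  s < rearrangement f t <-> ((t : R)%:E < leb (superlevel f s))%E.
Proof.
move=> t0 s0; rewrite /rearrangement t0.
set S := [set s | _].
have ubS : has_ubound S.
  have [s1 s1_gt0 s1P] := leb_superlevel_lt t0.
  exists s1 => s2 [_ s2P]; rewrite leNgt; apply/negP => s12.
  have := lt_trans s2P (le_lt_trans (leb_superlevel_antitone mf (ltW s12)) s1P).
  by rewrite ltxx.
split=> [sS|/(leb_superlevel_gt mf) [s' ss' s'P]]; last first.
  apply: (lt_le_trans ss'); apply: ub_le_sup => //.
  by split => //; exact: le_trans (ltW ss').
have [S0|/set0P S0] := eqVneq S set0.
  by move: sS; rewrite S0 sup0 ltNge s0.
have [s' [_ s'P] ss'] := sup_gt S0 sS.
by apply: lt_le_trans s'P _; exact: leb_superlevel_antitone (ltW ss').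
Qed.

Lemma rearrangement_ge0 (t : L) : 0 <= rearrangement f t.
Proof.
rewrite leNgt; apply/negP => ht.
have t0 : 0 < (t : R).
  by move: ht; rewrite /rearrangement; case: ifPn => //; rewrite ltxx.
move: ht; rewrite /rearrangement t0; set S := [set s | _].
have [supS|supS] := pselect (has_sup S); last by rewrite sup_out// ltxx.
have [[s Ss] ubS] := supS.
by rewrite ltNge (le_trans Ss.1)// ub_le_sup.
Qed.

Lemma rearrangement_antitone (x y : R) : 0 < x -> x <= y ->
  rearrangement f y <= rearrangement f x.
Proof.
move=> x0 xy; rewrite leNgt; apply/negP => hxy.
have := hxy; rewrite rearrangement_gt ?rearrangement_ge0 ?(lt_le_trans x0)//.
have /negP := negbT (ltxx (rearrangement f x)); rewrite rearrangement_gt ?rearrangement_ge0//.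
by move=> + yP; apply; apply: le_lt_trans yP; rewrite lee_fin.
Qed.

Lemma superlevel_rearrangement (s : R) : 0 <= s ->
  [set t : L | s < rearrangement f t] =
  [set t : L | 0 < (t : R) /\ ((t : R)%:E < leb (superlevel f s))%E].
Proof.
move=> s0; apply/seteqP; split=> t /=.
  move=> ht; have t0 : 0 < (t : R).
    move: ht; rewrite /rearrangement; case: ifPn => // _.
    by rewrite ltNge s0.
  by split=> //; exact/rearrangement_gt.
by move=> [t0]; exact: (rearrangement_gt t0 s0).2.
Qed.

Lemma measurable_rearrangement (D : set L) : measurable D ->
  measurable_fun D (rearrangement f).
Proof.
move=> mD _; apply: (measurability _ (RGenOInfty.measurableE R)) => //.
move=> _ [_ [s ->] <-]; apply: measurableI => //.
rewrite [X in measurable X](_ : _ = [set t : L | s < rearrangement f t]); last first.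
  by apply/seteqP; split=> t /=; rewrite in_itv/= andbT.
have [s0|s0] := leP 0 s.
  by rewrite superlevel_rearrangement//; exact: measurable_initial.
rewrite [X in measurable X](_ : _ = setT)//.
by apply/seteqP; split=> // t _ /=; apply: lt_le_trans s0 (rearrangement_ge0 t).
Qed.

(** The superlevel set of the rearrangement is an interval starting at [0] with the
measure of the superlevel set of [f]; it lies in [I] because [I] contains every
such interval of length at most its own measure. *)
Lemma equimeasurable_rearrangement : equimeasurable I f (rearrangement f).
Proof.
move=> s s0; rewrite -[LHS](@leb_initial)//; congr (leb _).
rewrite -[LHS]superlevel_rearrangement ?(ltW s0)//.
apply/seteqP; split=> t /=; rewrite ger0_norm ?rearrangement_ge0//; last by case.
move=> ht; split=> //.
have : [set t : L | s < rearrangement f t] t by [].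
rewrite superlevel_rearrangement ?(ltW s0)// => -[t0 tP].
apply: I_initial => //; apply: lt_le_trans tP _.
apply: le_measure; rewrite ?inE//; first exact: measurable_superlevel.
by move=> ? [].
Qed.

End one_function.

Lemma rearrangement_le (f g : L -> R) (t : L) :
  measurable_fun I f -> measurable_fun I g ->
  (forall s, 0 < s -> (leb (superlevel f s) < +oo)%E) ->
  (forall s, 0 < s -> (leb (superlevel g s) < +oo)%E) ->
  (forall t, I t -> `|f t| <= `|g t|) ->
  rearrangement f t <= rearrangement g t.
Proof.
move=> mf mg ff fg fg_le; have [t0|t0] := ltP 0 (t : R); last first.
  by rewrite /rearrangement ltNge t0.
rewrite leNgt; apply/negP => hfg.
have := hfg; rewrite (rearrangement_gt mf)// ?rearrangement_ge0// => tP.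
have /negP := negbT (ltxx (rearrangement g t)).
rewrite (rearrangement_gt mg)// ?rearrangement_ge0//; apply.
apply: lt_le_trans tP _; apply: le_measure; rewrite ?inE; try exact: measurable_superlevel.
by move=> u [Iu su]; split => //; apply: lt_le_trans su _; exact: fg_le.
Qed.

(** The superlevel sets of [f] cut down to [A n] decrease to the empty set and
have finite measure, so their measures, hence the rearrangements, tend to [0]. *)
Lemma rearrangement_cvg0 (f : L -> R) (A : nat -> set L) (t : L) :
  measurable_fun I f ->
  (forall s, 0 < s -> (leb (superlevel f s) < +oo)%E) ->
  (forall n, measurable (A n)) -> (forall n, A n.+1 `<=` A n) ->
  \bigcap_n A n = set0 ->
  rearrangement (f \* \1_(A n)) t @[n --> \oo] --> (0 : R).
Proof.
move=> mf fin mA dA A0; have [t0|t0] := ltP 0 (t : R); last first.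
  by apply: cvg_near_cst; apply: nearW => n; rewrite /rearrangement ltNge t0.
pose fA n := f \* \1_(A n).
have mfA n : measurable_fun I (fA n).
  by apply: measurable_funM; [exact: mf|exact: measurable_indic].
have finA n s : 0 < s -> (leb (superlevel (fA n) s) < +oo)%E.
  move=> s0; apply: le_lt_trans (fin _ s0).
  apply: le_measure; rewrite ?inE; try exact: measurable_superlevel.
  move=> u [Iu su]; split => //; apply: lt_le_trans su _.
  by rewrite normrM ler_piMr// indicE normr_nat lern1 leq_b1.
have niA m n : (m <= n)%N -> A n `<=` A m.
  elim: n => [|n ih]; first by rewrite leqn0 => /eqP ->.
  rewrite leq_eqVlt => /orP[/eqP -> //|]; rewrite ltnS => /ih.
  by apply: subset_trans; exact: dA.
apply/cvgr0Pnorm_le => e e0.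
pose F n := superlevel (fA n) e.
have mF n : measurable (F n) by exact: measurable_superlevel.
have FA n u : F n u -> A n u.
  move=> [_]; rewrite /fA /= indicE; have [/set_mem //|_] := boolP (u \in A n).
  by rewrite mulr0 normr0 ltNge (ltW e0).
have FE : \bigcap_n F n = set0.
  by rewrite -subset0 -A0 => u Fu n _; apply: FA; exact: Fu.
have niF : nonincreasing_seq F.
  move=> m n mn; apply/subsetPset => u Fnu; split; first by case: Fnu.
  have [_] := Fnu; rewrite /fA /= !indicE.
  by rewrite (mem_set (FA _ _ Fnu)) (mem_set (niA _ _ mn _ (FA _ _ Fnu))).
have mFE : measurable (\bigcap_n F n) by rewrite FE.
have := @nonincreasing_cvg_mu _ _ _ (@completed_lebesgue_measure R) F
  (finA _ _ e0) mF mFE niF.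
rewrite FE measure0 => F0.
have t0E : (0 < (t : R)%:E)%E by rewrite lte_fin.
have [m _ mP] := F0 _ (open_ereal_lt' t0E); exists m => // n mn.
rewrite ger0_norm; last exact: rearrangement_ge0.
rewrite leNgt; apply/negP => eh.
have := (rearrangement_gt (mfA n) (finA n) t0 (ltW e0)).1 eh.
by rewrite ltNge (ltW (mP n mn)).
Qed.

End rearrangement.

(** * Order continuity descends from the Copson space *)

Section converse.
Context {R : realType} (I : set (lebesgueType R)).
Notation L := (lebesgueType R).
Local Notation copson f := (copson_op I (fun t => `|f t|%R)).
Hypothesis hI : I = `[(0 : R), 1]%classic \/ I = `[(0 : R), +oo[%classic.

Lemma domain_measurable : measurable I.
Proof. by case: hI => ->; exact: borel_lebesgue. Qed.

Lemma domain_ge0 (t : L) : I t -> 0 <= (t : R).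
Proof. by case: hI => ->; rewrite /= in_itv/= => /andP[]. Qed.

Lemma domain_initial (t : R) : 0 < t -> (t%:E < leb I)%E -> I t.
Proof.
move=> t0; case: hI => -> /=; rewrite in_itv/= (ltW t0)//=.
by rewrite [X in (_ < X)%E]leb_itv/= lte_fin ltr01 -EFinB subr0 lte_fin => /ltW.
Qed.

Lemma domain_sub (x t : R) : I x -> 0 <= t -> t <= x -> I t.
Proof.
case: hI => -> /=; rewrite !in_itv/= => + -> //=.
by move=> /andP[_ x1] tx; exact: le_trans x1.
Qed.

Let mI := domain_measurable.

(** If it were finite at [x], its tails beyond [n] would tend to [0] as [n] grows;
but each block [[n, 2 n]] contributes at least [1 / 2]. *)
Lemma copson_one_infinite (x : R) : I = `[(0 : R), +oo[%classic -> 0 < x ->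
  copson (cst (1 : R)) x \isn't a fin_num.
Proof.
move=> IE x0; apply/negP => fin1.
pose A n : set L := `[n%:R, +oo[%classic.
have mA n : measurable (A n) by rewrite /A; exact: borel_lebesgue.
have dA n : A n.+1 `<=` A n.
  move=> t; rewrite /A /= !in_itv/= !andbT; apply: le_trans.
  by rewrite ler_nat.
have A0 : \bigcap_n A n = set0.
  rewrite -subset0 => t /(_ (Num.bound `|t : R|) Logic.I).
  rewrite /A /= in_itv/= andbT leNgt => /negP; apply.
  by rewrite (le_lt_trans (ler_norm _))// archi_boundP.
have := copson_cvg0 mI domain_ge0 (measurable_cst (1 : R)) mA dA A0 fin1.
have half0 : (0 < (2^-1 : R)%:E)%E by rewrite lte_fin.
move=> /(_ _ (open_ereal_lt' half0)) [m _ mP].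
pose n := maxn m (Num.bound x).
have xn : x <= n%:R.
  rewrite (le_trans (ltW (archi_boundP (ltW x0))))// ler_nat; exact: leq_maxr.
have n0 : 0 < n%:R :> R by exact: lt_le_trans xn.
have := mP n (leq_maxl _ _); rewrite /= ltNge => /negP; apply.
have -> : (2^-1 : R) = 1 / (2 * n%:R) * (2 * n%:R - n%:R).
  by move: n%:R n0 => r r0; field; exact: lt0r_neq0.
apply: copson_ge_block.
- exact: mI.
- exact: domain_ge0.
- by apply: measurable_funM; [exact: measurable_cst|exact: measurable_indic].
- move=> t /=; rewrite IE /= !in_itv/= andbT => /andP[nt _].
  by exact: le_trans nt; exact: ltW.
- by rewrite n0 ler_peMl ?(ltW n0)// ler1n.
- exact: xn.
- exact: ler01.
- move=> t /andP[nt _]; rewrite /= mul1r indicE mem_set ?normr1//.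
  by rewrite /A /= in_itv/= nt.
Qed.

Section space.
Variable X : function_space R.
Hypothesis hX : symmetric_space I X.

Let iX : normed_ideal I X := bfs_normed_ideal hX.1.

Section copson_bounded.
Hypothesis hCstar : bounded_operator I X (copson_op I).

Lemma sub_copson_space (f : L -> R) : X f -> copson_space I X f.
Proof.
have [K KP] := hCstar; move=> Xf.
have mf : measurable_fun I f := ideal_measurable iX Xf.
have Xabs : X (fun t => `|f t|).
  apply: (ideal_le iX _ Xf _).1.
    by apply: measurableT_comp mf; exact: normr_measurable.
  by apply: aeW => t _; rewrite normr_id.
split; first exact: mf.
exact: (KP _ Xabs).1.
Qed.

(** If [S], the superlevel set, had infinite measure, then [I] would be the
half-line, the indicator of [S] would be in [X] and equimeasurable with the
constant [1], so that the Copson function of [1] would be finite a.e. *)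
Lemma superlevel_finite (f : L -> R) (s : R) : X f -> 0 < s ->
  (leb (superlevel I f s) < +oo)%E.
Proof.
move=> Xf s0; have mf : measurable_fun I f := ideal_measurable iX Xf.
have mS := measurable_superlevel mI s mf.
case: (hI) => IE.
  apply: (@le_lt_trans _ _ (leb I)).
    apply: le_measure; rewrite ?inE; [exact: mS|exact: mI|].
    by move=> t [].
  by rewrite IE [X in (X < _)%E]leb_itv/= lte_fin ltr01 -EFinB ltry.
have lebI : leb I = +oo%E by rewrite IE [LHS]leb_itv/= ltry.
rewrite ltey; apply/negP => /eqP Soo.
have mone : measurable_fun I (\1_(superlevel I f s) : L -> R).
  exact: measurable_indic.
have Xind : X (\1_(superlevel I f s)).
  apply: (ideal_le iX mone (idealZ iX s^-1 Xf).1 _).1.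
  apply: aeW => t It; rewrite indicE.
  have [/set_mem[_ st]|_] := boolP (t \in _); last by rewrite normr0.
  by rewrite normr1 normrM gtr0_norm ?invr_gt0// ler_pdivlMl// mulr1 ltW.
have X1 : X (cst 1).
  apply: (hX.2 _ _ mone (measurable_cst _) _ Xind).1 => r r0.
  have [r1|r1] := ltP r 1.
    transitivity (leb (superlevel I f s)).
      congr (leb _); apply/seteqP; split=> t.
        move=> [_]; rewrite indicE; have [/set_mem //|_] := boolP (t \in _).
        by rewrite normr0 ltNge ltW.
      by move=> St; split; [case: St|rewrite indicE mem_set// normr1].
    rewrite Soo -lebI; congr (leb _); apply/seteqP; split=> t; last by case.
    by move=> It; split=> //; rewrite normr1.
  transitivity (leb (@set0 L)); last symmetry; congr (leb _);
    rewrite -subset0 => t [_].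
    rewrite indicE ltNge => /negP; apply; apply: le_trans r1.
    by rewrite normr_nat lern1 leq_b1.
  by rewrite /= normr1 ltNge r1.
have [_ [fin1 _]] := sub_copson_space X1.
have [N [mN N0 subN]] := fin1.
have : (leb (`]0%R, +oo[%classic : set L) <= leb N)%E.
  apply: le_measure; rewrite ?inE; [exact: borel_lebesgue|exact: mN|].
  move=> t /=; rewrite in_itv/= andbT => t0; apply: subN => /=.
  have It : I t by rewrite IE /= in_itv/= andbT ltW.
  by move=> /(_ It); exact/negP/copson_one_infinite.
by rewrite [X in (X <= _)%E]leb_itv/= ltry N0 leye_eq.
Qed.

End copson_bounded.

Section cesaro_bounded.
Variable K : R.
Hypothesis hC : forall f, X f -> emem I X (@cesaro_op R f) /\
  fnorm X (fine \o @cesaro_op R f) <= K * fnorm X f.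

(** For [t <= x / 2] the block [[x / 2, x]], where [h >= h x], contributes at
least [h x / x * (x / 2) = h x / 2] to the Copson function at [t].  Averaging over
[[0, x]], only half of which consists of such [t], loses another factor [2]. *)
Lemma le_cesaro_copson (h : L -> R) (x : R) : measurable_fun I h ->
  (forall s t : R, 0 < s -> s <= t -> h t <= h s) -> (forall t, 0 <= h t) ->
  {ae leb, forall t, I t -> copson h t \is a fin_num} ->
  0 < x -> I x ->
  ((h x / 4)%:E <= cesaro_op (fine \o copson h) x)%E.
Proof.
move=> mh hni h0 fin x0 Ix.
have x2 : 0 < x / 2 by rewrite divr_gt0.
have x2x : x / 2 <= x by rewrite ler_pdivrMr// ler_peMr ?ltW// ltr1n.
pose J0x : set L := `[0%R, x]%classic; pose J02 : set L := `]0%R, x / 2]%classic.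
have m0x : measurable J0x by rewrite /J0x; exact: borel_lebesgue.
have m02 : measurable J02 by rewrite /J02; exact: borel_lebesgue.
have sI : J0x `<=` I.
  move=> t; rewrite /J0x /=; rewrite in_itv/= => /andP[t0 tx]; exact: domain_sub Ix t0 tx.
have s2 : J02 `<=` J0x.
  move=> t; rewrite /J0x /J02 /=; rewrite !in_itv/= => /andP[t0 tx].
  by rewrite (ltW t0) (le_trans tx).
have mC : measurable_fun I (EFin \o (fine \o copson h)).
  by apply/measurable_EFinP; exact: measurable_fine_copson mI domain_ge0 _ mh.
have C0 t : (0 <= ((fine \o copson h) t)%:E)%E.
  by rewrite lee_fin fine_ge0// copson_ge0//; exact: domain_ge0.
have -> : h x / 4 = x^-1 * (h x / 2 * (x / 2)).
  by field; rewrite lt0r_neq0.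
rewrite EFinM /cesaro_op -/J0x; apply: lee_wpmul2l; first by rewrite lee_fin invr_ge0 ltW.
apply: (@le_trans _ _ (\int[leb]_(t in J02)
   ((fine \o copson h) t)%:E)%E); last first.
  apply: ge0_subset_integral; [exact: m02|exact: m0x| |by move=> t _; exact: C0|exact: s2].
  exact: measurable_funS mI sI mC.
apply: (@le_trans _ _ (\int[leb]_(t in J02)
   cst (h x / 2)%:E t)%E).
  rewrite integral_cst; last exact: m02.
  by rewrite [X in (_ * X)%E]leb_itv/= lte_fin x2 -EFinB subr0.
apply: ae_ge0_le_integral.
- exact: m02.
- by move=> t _; rewrite lee_fin divr_ge0.
- exact: measurable_cst.
- by move=> t _; exact: C0.
- exact: measurable_funS mI (subset_trans s2 sI) mC.
apply: filterS fin => t fin t2.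
have It : I t by exact/sI/s2.
rewrite fineK ?fin//.
have -> : h x / 2 = h x / x * (x - x / 2) by field; rewrite lt0r_neq0.
move: t2; rewrite /J02 /= in_itv/= => /andP[t0 tx2].
apply: copson_ge_block.
- exact: mI.
- exact: domain_ge0.
- exact: mh.
- move=> u /=; rewrite in_itv/= => /andP[ux xu].
  by apply: (domain_sub Ix _ xu); rewrite (le_trans (ltW x2)).
- by rewrite x2.
- exact: tx2.
- exact: h0.
- move=> u /andP[xu ux]; rewrite ger0_norm//; apply: hni ux.
  exact: lt_le_trans xu.
Qed.

Lemma norm_le_copson (h : L -> R) : copson_space I X h ->
  (forall s t : R, 0 < s -> s <= t -> h t <= h s) -> (forall t, 0 <= h t) ->
  fnorm X h <= 4 * K * fnorm (copson_space I X) h.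
Proof.
move=> [mh [fin XC]] hni h0.
have [[finC XCC] nCC] := hC XC.
have [X4 n4] := idealZ iX 4 XCC.
rewrite -mulrA; apply: le_trans (ler_wpM2l _ nCC) => //.
rewrite -[X in _ <= X * _]ger0_norm// -n4.
apply: (ideal_le iX mh X4 _).2.
apply: filterS2 finC ae_neq0 => x finC xN0 Ix.
have x0 : 0 < (x : R) by rewrite lt0r domain_ge0// andbT; apply/eqP.
rewrite ger0_norm//; apply: le_trans (ler_norm _).
have := le_cesaro_copson mh hni h0 fin x0 Ix.
rewrite -[X in (_ <= X)%E -> _]fineK ?finC// lee_fin.
by rewrite ler_pdivrMr// mulrC.
Qed.

End cesaro_bounded.

(** The restrictions of [f] are replaced by their rearrangements [h n], which have
the same norm in [X] and for which this norm is controlled by the Copson norm. *)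
Lemma order_continuous_of_copson_space :
  bounded_operator I X (@cesaro_op R) ->
  bounded_operator I X (copson_op I) ->
  order_continuous I (copson_space I X) -> order_continuous I X.
Proof.
move=> [K hC] hCstar ocC f Xf A mA AI dA A0.
have mf : measurable_fun I f := ideal_measurable iX Xf.
have fin s : 0 < s -> (leb (superlevel I f s) < +oo)%E.
  by exact: superlevel_finite.
pose fA n := f \* \1_(A n); pose h n := rearrangement I (fA n).
have XfA n : X (fA n) by rewrite /fA; exact: (ideal_restrict iX (mA n) Xf).
have mfA n : measurable_fun I (fA n) := ideal_measurable iX (XfA n).
have finA n s : 0 < s -> (leb (superlevel I (fA n) s) < +oo)%E.
  by move=> s0; exact: superlevel_finite.
have mh n : measurable_fun I (h n).
  exact: (measurable_rearrangement mI (mfA n) (finA n) mI).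
have mH : measurable_fun I (rearrangement I f).
  exact: (measurable_rearrangement mI mf fin mI).
have [XH _] := hX.2 _ _ mf mH
  (equimeasurable_rearrangement mI domain_initial mf fin) Xf.
have hP n := hX.2 _ _ (mfA n) (mh n)
  (equimeasurable_rearrangement mI domain_initial (mfA n) (finA n)) (XfA n).
have h_cvg0 : fnorm (copson_space I X) (h n) @[n --> \oo] --> (0 : R).
  apply: (order_continuous_dominated mI _ ocC (sub_copson_space hCstar XH)).
  - exact: copson_normed_ideal mI domain_ge0 iX.
  - exact: mh.
  apply: aeW => t _; split; last first.
    exact: (rearrangement_cvg0 mI t mf fin mA dA A0).
  move=> n; rewrite ger0_norm ?rearrangement_ge0//.
  apply: (rearrangement_le mI t (mfA n) mf (finA n) fin) => u _.
  by rewrite /fA normrM ler_piMr// indicE normr_nat lern1 leq_b1.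
have le_h n : fnorm X (fA n) <= 4 * K * fnorm (copson_space I X) (h n).
  rewrite (hP n).2; apply: (norm_le_copson hC).
  - exact: (sub_copson_space hCstar (hP n).1).
  - by move=> s t; exact: (rearrangement_antitone mI (mfA n) (finA n)).
  - exact: (rearrangement_ge0 I (fA n)).
apply: (@squeeze_cvgr _ _ _ _ (cst 0) (fun n => 4 * K * fnorm (copson_space I X) (h n))).
- by apply: nearW => n; rewrite (ideal_norm_ge0 iX (XfA n)) le_h.
- exact: cvg_cst.
- by rewrite -[X in _ --> X](mulr0 (4 * K)); exact: cvgMr h_cvg0.
Qed.

End space.
End converse.

Theorem corollary6p1 (R : realType) (I : set (lebesgueType R))
    (hI : I = `[(0 : R), 1]%classic \/ I = `[(0 : R), +oo[%classic)
    (X : function_space R) (hX : symmetric_space I X)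
    (hC : bounded_operator I X (@cesaro_op R))
    (hCstar : bounded_operator I X (copson_op I)) :
  order_continuous I (copson_space I X) <-> order_continuous I X.
Proof.
split; first exact: (order_continuous_of_copson_space hI hX hC hCstar).
apply: order_continuous_copson_space (bfs_normed_ideal hX.1).
  exact: (domain_measurable hI).
exact: (domain_ge0 hI).
Qed.
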